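(* Let $F$ be a distribution on ${\bf R}^+=[0,\infty)$ and let $H$ be a non-zero non-negative measure on ${\bf R}^+$ such that $\int_0^\infty\overline F(t)\,H(dt)<\infty$. Let $G_H$ be the distribution on ${\bf R}^+$ with tail $$\overline G_H(x)=\min\Biggl(1,\int_0^\infty\overline F(x+t)\,H(dt)\Biggr),\quad x\ge 0 .$$ If $F$ is both dominated varying and long-tailed, then $G_H$ is both dominated varying and long-tailed and, therefore, $G_H$ is subexponential.
   Context: For a distribution $G$, $\overline G(x)=G((x,\infty))$. The integrals $\int_0^\infty\cdots H(dt)$ are over $[0,\infty)$, including a possible atom of $H$ at $0$. A distribution $G$ is long-tailed if, for every fixed $t$, $\overline G(x+t)/\overline G(x)\to 1$ as $x\to\infty$ (in particular $\overline G(x)>0$ for all $x$). A distribution $G$ on ${\bf R}^+$ is dominated varying if, for some $c>0$, $\overline G(2x)\ge c\,\overline G(x)$ for all $x\ge 0$. A distribution $G$ on ${\bf R}^+$ with unbounded support is subexponential if $\overline{G*G}(x)\sim 2\overline G(x)$ as $x\to\infty$, where $*$ denotes convolution and $f\sim g$ means $f/g\to1$. *)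

(* Defs.v *)
From HB Require Import structures.
From mathcomp Require Import all_boot all_order all_algebra.
From mathcomp Require Import all_classical all_reals all_analysis.

Set Implicit Arguments.
Unset Strict Implicit.
Unset Printing Implicit Defensive.

Import Order.TTheory GRing.Theory Num.Theory.
Import numFieldNormedType.Exports.

Local Open Scope classical_set_scope.
Local Open Scope ring_scope.

(* A Borel measure on [0, +oo[ is represented by a Borel measure on the line
   that does not charge the negative half-line. *)
Definition on_Rplus (R : realType) (mu : set (measurableTypeR R) -> \bar R) :
  Prop := mu `]-oo, 0[%classic = 0%E.

(* Only used for finite measures, for which [fine] loses nothing. *)
Definition tail (R : realType) (mu : set (measurableTypeR R) -> \bar R)
  (x : R) : R := fine (mu `]x, +oo[%classic).

Definition convolution (R : realType)
    (F G : probability (measurableTypeR R) R) :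
    set (measurableTypeR R) -> \bar R :=
  pushforward (F \x G)%E
    (fun z : measurableTypeR R * measurableTypeR R =>
      (z.1 + z.2 : measurableTypeR R)).

(* Positivity makes the quotients meaningful; it also follows from the limit
   at t = 0, since x / 0 = 0. *)
Definition long_tailed (R : realType)
    (G : probability (measurableTypeR R) R) : Prop :=
  (forall x : R, 0 < tail G x) /\
  (forall t : R, tail G (x + t) / tail G x @[x --> +oo] --> (1 : R)).

Definition dominated_varying (R : realType)
    (G : probability (measurableTypeR R) R) : Prop :=
  on_Rplus G /\
  exists2 c : R, 0 < c & forall x : R, 0 <= x -> c * tail G x <= tail G (2 * x).

(* Positivity of the tail says that the support is unbounded. *)
Definition subexponential (R : realType)
    (G : probability (measurableTypeR R) R) : Prop :=
  [/\ on_Rplus G,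
      forall x : R, 0 < tail G x &
      tail (convolution G G) x / (2 * tail G x) @[x --> +oo] --> (1 : R)].

(* The values of the tail on [0, +oo[ determine a distribution on [0, +oo[. *)
Definition is_tail_mixture (R : realType)
    (F : probability (measurableTypeR R) R)
    (H : {measure set (measurableTypeR R) -> \bar R})
    (G : probability (measurableTypeR R) R) : Prop :=
  on_Rplus G /\
  forall x : R, 0 <= x ->
    (tail G x)%:E =
    Order.min 1%E (\int[H]_(t in `[0%R, +oo[) (tail F (x + t))%:E)%E.

(* Main.v *)
Require Import Defs.
From HB Require Import structures.
From mathcomp Require Import all_boot all_order all_algebra.
From mathcomp Require Import all_classical all_reals all_analysis.
From mathcomp Require Import measurable_realfun lra.

Import Order.TTheory GRing.Theory Num.Theory.
Import numFieldNormedType.Exports.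

Local Open Scope classical_set_scope.
Local Open Scope ring_scope.

(** Write m(x) for the integral of the tail of F at x + t against H(dt), so that
    the tail of the mixture G is min(1, m) on the positive half-line.

    Both properties of F are lower bounds of the form
      k * tail F (x + s) <= tail F (y + s), uniformly in s >= 0,
    with k <= 1.  Dominated variation gives one with y = 2x, because
    2x + s <= 2(x + s) and the tail is nonincreasing.  Long-tailedness gives one
    with y = x + t, for every t >= 0 and k < 1, as soon as x is large: the point
    x + s is then large for all s >= 0 at once.  Such a bound can be integrated
    against H and survives truncation at 1 when k <= 1 ([mixture_compare]), so
    G inherits both properties.  That lower bounds suffice for long-tailedness
    is [long_tailedP]: the tail is monotone, so an upper bound on the ratio at x
    is a lower bound at a shifted point.

    For subexponentiality, let X and Y be independent with law G.  Since
    X, Y >= 0, the event X + Y > x contains (X > x) or (Y > x), of probability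
    2 tail G x - (tail G x)^2.  Conversely it forces X > x - A, or Y > x - A, or
    both variables to exceed A and one of them to exceed x / 2.  The first two
    cases contribute about 2 tail G x by long-tailedness; the last contributes at
    most 2 tail G A * tail G (x / 2) <= 2 (tail G A / c) tail G x by dominated
    variation, which is negligible for A large.

    For existence, m is finite, nonincreasing, right-continuous and tends to 0
    at infinity, the last two by dominated convergence with the tail of F as
    dominating function ([cvg_mixed_tail]).  Hence 1 - min(1, m), extended by 0
    to the negative half-line, is a distribution function and G is its
    Lebesgue-Stieltjes measure. *)

(** * Tails of distributions *)

(** With the identity as random variable, the tail of a distribution is a
    complementary distribution function and has its limits and continuity. *)
Definition identity_rv (R : realType) : measurableTypeR R -> R := idfun.

HB.instance Definition _ (R : realType) :=
  @isMeasurableFun.Build _ _ _ _ (@identity_rv R) (@measurable_id _ _ setT).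

Lemma tailE (R : realType) (G : probability (measurableTypeR R) R) (x : R) :
  (tail G x)%:E = ccdf (@identity_rv R : {RV G >-> R}) x.
Proof.
by rewrite /tail /ccdf /distribution /pushforward preimage_id fineK
  ?fin_num_measure.
Qed.

Lemma tail_measure (R : realType) (G : probability (measurableTypeR R) R) (x : R) :
  G `]x, +oo[%classic = (tail G x)%:E.
Proof. by rewrite /tail fineK ?fin_num_measure. Qed.

Lemma tail_ge0 (R : realType) (G : probability (measurableTypeR R) R) (x : R) :
  0 <= tail G x.
Proof. exact: fine_ge0. Qed.

Lemma tail_nonincreasing (R : realType) (G : probability (measurableTypeR R) R) :
  {homo tail G : x y / x <= y >-> y <= x}.
Proof. by move=> x y xy; rewrite -lee_fin !tailE; exact: ccdf_nonincreasing. Qed.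

Lemma cvg_tail_y (R : realType) (G : probability (measurableTypeR R) R) :
  tail G x @[x --> +oo] --> (0 : R).
Proof.
apply/fine_cvg; under eq_cvg do rewrite tail_measure tailE.
exact: cvg_ccdfy0.
Qed.

Lemma tail_right_continuous (R : realType) (G : probability (measurableTypeR R) R) :
  right_continuous (tail G).
Proof.
move=> p; apply/fine_cvg; rewrite tailE.
under eq_cvg do rewrite tail_measure tailE.
exact: ccdf_right_continuous.
Qed.

Lemma measurable_tail_shift (R : realType) (G : probability (measurableTypeR R) R)
    (D : set (measurableTypeR R)) (x : R) :
  measurable D ->
  measurable_fun D ((fun t => (tail G (x + t))%:E) : measurableTypeR R -> \bar R).
Proof.
move=> mD; apply/measurable_EFinP; apply: nonincreasing_measurable => // s t st.
by apply: tail_nonincreasing; rewrite lerD2l.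
Qed.

Lemma measure_Rplus (R : realType) (mu : {measure set (measurableTypeR R) -> \bar R}) :
  on_Rplus mu -> mu `[0, +oo[%classic = mu setT.
Proof.
move=> mu0; rewrite -[LHS]add0e -mu0 -measureU//; first last.
  by apply/seteqP; split => // x /= []; rewrite !in_itv/= => x0; rewrite andbT leNgt x0.
congr (mu _); apply/seteqP; split => // x _ /=; rewrite !in_itv/= andbT.
by case: (ltP x 0) => ?; [left|right].
Qed.

(** Both x and x + t lie between x - |t| and x + |t|, so the tails at x and x + t
    lie between the tails at these two points.  The lower bound for the shift
    2|t| at x - |t| thus controls their ratio from both sides. *)
Lemma long_tailedP (R : realType) (G : probability (measurableTypeR R) R) :
  long_tailed G <-> (forall x : R, 0 < tail G x) /\
    (forall t k : R, 0 <= t -> 0 < k < 1 ->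
       \forall x \near +oo, k * tail G x <= tail G (x + t)).
Proof.
split=> -[G0 Glt]; split=> //.
  move=> t k t0 /andP[k0 k1].
  have := Glt t => /cvgr_ge/(_ k k1).
  by apply: filterS => x; rewrite ler_pdivlMr.
move=> t; apply/cvgrPdist_le => e e0.
(* This k makes 1 / k = 1 + e, and then also k >= 1 - e. *)
have k01 : 0 < (1 + e)^-1 < 1 by rewrite invr_gt0 invf_lt1; lra.
have := Glt (`|t| + `|t|) _ _ k01 => /(_ ltac:(by rewrite addr_ge0)) h.
have : \forall x \near +oo, (1 + e)^-1 * tail G (x - `|t|) <= tail G (x + `|t|).
  have shift : (fun x : R => x - `|t|) @ +oo --> +oo.
    by apply/cvgryPge => A; near=> x; rewrite lerBrDr; near: x;
      apply: nbhs_pinfty_ge; exact: num_real.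
  have : \forall x \near +oo, (1 + e)^-1 * tail G (x - `|t|) <=
      tail G (x - `|t| + (`|t| + `|t|)) := shift _ h.
  by apply: filterS => x; rewrite addrA subrK.
apply: filterS => x; rewrite mulrC ler_pdivrMr; last lra.
set a := tail G (x - `|t|); set b := tail G (x + `|t|) => ab.
have := G0 x; have xa : tail G x <= a by apply: tail_nonincreasing; rewrite lerBlDr lerDl.
have bx : b <= tail G x by apply: tail_nonincreasing; rewrite lerDl.
have ta : tail G (x + t) <= a.
  by apply: tail_nonincreasing; rewrite lerD2l lerNl ler_normr lexx orbT.
have bt : b <= tail G (x + t) by apply: tail_nonincreasing; rewrite lerD2l ler_norm.
move=> x0; rewrite distrC ler_norml lerBrDr lerBlDr ler_pdivlMr// ler_pdivrMr//.
apply/andP; split; nra.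
Unshelve. all: by end_near. Qed.

(** * Mixtures inherit dominated variation and long tails *)

Definition mixed_tail {R : realType} (F : probability (measurableTypeR R) R)
  (H : {measure set (measurableTypeR R) -> \bar R}) (x : R) : \bar R :=
  (\int[H]_(t in `[0%R, +oo[) (tail F (x + t))%:E)%E.

Lemma mixed_tail_ge0 (R : realType) (F : probability (measurableTypeR R) R)
    (H : {measure set (measurableTypeR R) -> \bar R}) (x : R) :
  (0 <= mixed_tail F H x)%E.
Proof. by apply: integral_ge0 => t _; rewrite lee_fin tail_ge0. Qed.

Lemma mixed_tail_compare (R : realType) (F : probability (measurableTypeR R) R)
    (H : {measure set (measurableTypeR R) -> \bar R}) (k x y : R) :
  0 <= k -> (forall t, 0 <= t -> k * tail F (x + t) <= tail F (y + t)) ->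
  (k%:E * mixed_tail F H x <= mixed_tail F H y)%E.
Proof.
move=> k0 kF; rewrite /mixed_tail -ge0_integralZl//; first last.
- by move=> t _; rewrite lee_fin tail_ge0.
- exact: measurable_tail_shift.
apply: ge0_le_integral => //.
- by move=> t _; rewrite -EFinM lee_fin mulr_ge0 ?tail_ge0.
- by apply: emeasurable_funM => //; exact: measurable_tail_shift.
- exact: measurable_tail_shift.
- by move=> t /=; rewrite in_itv/= andbT -EFinM lee_fin; exact: kF.
Qed.

Lemma mixed_tail_nonincreasing (R : realType) (F : probability (measurableTypeR R) R)
    (H : {measure set (measurableTypeR R) -> \bar R}) (x y : R) :
  x <= y -> (mixed_tail F H y <= mixed_tail F H x)%E.
Proof.
move=> xy; rewrite -[leLHS]mul1e; apply: mixed_tail_compare => // t _.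
by rewrite mul1r tail_nonincreasing// lerD2r.
Qed.

Lemma mixed_tail_gt0 (R : realType) (F : probability (measurableTypeR R) R)
    (H : {measure set (measurableTypeR R) -> \bar R}) (x : R) :
  on_Rplus H -> H setT <> 0%E -> (forall x, 0 < tail F x) ->
  (0 < mixed_tail F H x)%E.
Proof.
move=> Hp H0 F0; rewrite lt_neqAle mixed_tail_ge0 andbT eq_sym.
apply/eqP => m0; apply: H0; rewrite -measure_Rplus//.
have : (\int[H]_(t in `[0%R, +oo[) `|(tail F (x + t))%:E| = 0)%E.
  rewrite -[RHS]m0; apply: eq_integral => t _.
  by rewrite gee0_abs// lee_fin tail_ge0.
move/ae_eq_integral_abs => /= -[]// .
- exact: measurable_tail_shift.
move=> N [mN N0 sub]; apply: (subset_measure0 _ mN) N0 => //.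
move=> t t0; apply: sub => /= /(_ t0)/eqP.
by rewrite eqe gt_eqF.
Qed.

(** The condition k <= 1 is what makes the bound compatible with truncation:
    k * min(1, m x) is at most k <= 1 and at most k * m x. *)
Lemma mixture_compare (R : realType) (F G : probability (measurableTypeR R) R)
    (H : {measure set (measurableTypeR R) -> \bar R}) (k x y : R) :
  is_tail_mixture F H G -> 0 <= x -> 0 <= y -> 0 <= k <= 1 ->
  (forall t, 0 <= t -> k * tail F (x + t) <= tail F (y + t)) ->
  k * tail G x <= tail G y.
Proof.
move=> [_ GE] x0 y0 /andP[k0 k1] kF; rewrite -lee_fin EFinM !GE//.
have := @mixed_tail_compare _ F H _ _ _ k0 kF.
rewrite /mixed_tail => kH; rewrite le_min; apply/andP; split.
  apply: le_trans (_ : k%:E * 1 <= _)%E; last by rewrite mule1 lee_fin.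
  by rewrite lee_pmul// ?ge_min ?lexx// le_min lee01 mixed_tail_ge0.
apply: le_trans kH.
by rewrite lee_pmul// ?ge_min ?lexx ?orbT// le_min lee01 mixed_tail_ge0.
Qed.

(** Evaluating the dominated variation of F at 0, where 2 * 0 = 0, shows that
    its constant is at most 1, so the same constant serves for G. *)
Lemma mixture_dominated_varying (R : realType) (F G : probability (measurableTypeR R) R)
    (H : {measure set (measurableTypeR R) -> \bar R}) :
  is_tail_mixture F H G -> (0 < tail F 0) -> dominated_varying F ->
  dominated_varying G.
Proof.
move=> FHG F0 [_ [c c0 cF]]; split; first exact: FHG.1.
have c1 : c <= 1.
  by have := cF 0 (lexx _); rewrite mulr0 ger_pMl.
exists c => // x x0; apply: (mixture_compare _ _ _ _ _ _ _ FHG);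
  rewrite ?mulr_ge0 ?(ltW c0)//.
move=> t t0; apply: (le_trans (cF _ (addr_ge0 x0 t0))).
by apply: tail_nonincreasing; lra.
Qed.

Lemma mixture_long_tailed (R : realType) (F G : probability (measurableTypeR R) R)
    (H : {measure set (measurableTypeR R) -> \bar R}) :
  is_tail_mixture F H G -> on_Rplus H -> H setT <> 0%E ->
  long_tailed F -> long_tailed G.
Proof.
move=> FHG Hp H0 /long_tailedP[F0 Flt]; apply/long_tailedP; split.
  move=> x; apply: (@lt_le_trans _ _ (tail G (Num.max 0 x))); last first.
    by apply: tail_nonincreasing; rewrite le_max lexx orbT.
  rewrite -lte_fin FHG.2 ?le_max ?lexx// lt_min lte01/=.
  exact: mixed_tail_gt0.
move=> t k t0 /andP[k0 k1].
have [M [_ FM]] := Flt _ _ t0 (introT andP (conj k0 k1)).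
near=> x.
have x0 : 0 <= x by near: x; apply: nbhs_pinfty_ge; exact: num_real.
(* One threshold M serves for all s >= 0, since x + s stays beyond it. *)
apply: (mixture_compare _ _ _ _ _ _ _ FHG); rewrite ?(ltW k0) ?(ltW k1) ?addr_ge0//.
move=> s s0; rewrite addrAC; apply: FM.
by apply: (@lt_le_trans _ _ x); rewrite ?lerDl//; near: x;
  apply: nbhs_pinfty_gt; exact: num_real.
Unshelve. all: by end_near. Qed.

(** * Subexponentiality *)

Lemma measurable_sum_gt (R : realType) (x : R) :
  measurable ((fun z : measurableTypeR R * measurableTypeR R =>
      (z.1 + z.2 : measurableTypeR R)) @^-1` `]x, +oo[%classic).
Proof.
rewrite -[X in measurable X]setTI.
exact: (@measurable_funD _ _ R setT fst snd measurable_fst measurable_snd).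
Qed.

(** Restated for probabilities so that both factors appear as values of G, to
    which [tail_measure] applies. *)
Lemma product_probabilityE (R : realType) (G : probability (measurableTypeR R) R)
    (A B : set (measurableTypeR R)) :
  measurable A -> measurable B -> (G \x G)%E (A `*` B) = (G A * G B)%E.
Proof. exact: product_measure1E. Qed.

(** The event (X > x) or (Y > x) is split into the disjoint rectangles
    (X > x, Y >= 0) and (0 <= X <= x, Y > x). *)
Lemma convolution_tail_ge (R : realType) (G : probability (measurableTypeR R) R)
    (x : R) : on_Rplus G -> 0 <= x ->
  ((2 * tail G x - tail G x ^+ 2)%:E <= convolution G G `]x, +oo[%classic)%E.
Proof.
move=> G0 x0; rewrite /convolution /pushforward.
pose A : set (measurableTypeR R * measurableTypeR R) := `]x, +oo[ `*` `[0, +oo[.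
pose B : set (measurableTypeR R * measurableTypeR R) := `[0, x] `*` `]x, +oo[.
have mA : measurable A by exact: measurableX.
have mB : measurable B by exact: measurableX.
apply: (@le_trans _ _ ((G \x G)%E (A `|` B))); last first.
  rewrite le_measure ?inE//; [exact: measurableU|exact: measurable_sum_gt|].
  move=> [u v] /= [[]|[]] /=; rewrite !in_itv/= !andbT; first by lra.
  by move=> /andP[u0 _] xv; lra.
rewrite measureU//; last first.
  apply/seteqP; split => // -[u v] /= [[] + _ [] + _].
  by rewrite /= !in_itv/= andbT => xu /andP[_ ux]; lra.
have GR : G `[0, +oo[%classic = 1%E.
  exact: etrans (measure_Rplus _ _ G0) (probability_setT G).
have Gx : G `[0, x]%classic = (1 - tail G x)%:E.
  rewrite EFinB -tail_measure -GR.
  have -> : (`[0, +oo[ = `[0, x] `|` `]x, +oo[ :> set (measurableTypeR R))%classic.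
    by rewrite -itv_bndbnd_setU ?bnd_simp.
  rewrite measureU//= ?addeK ?fin_num_measure//.
  apply/seteqP; split => // y /= []; rewrite !in_itv/= => /andP[_ yx].
  by rewrite andbT ltNge yx.
rewrite /A /B /= !product_probabilityE// GR Gx !tail_measure.
by rewrite mule1 -EFinM -EFinD lee_fin; lra.
Qed.

(** If neither variable exceeds x - A, then X + Y > x forces both to exceed A,
    and the larger one exceeds x / 2. *)
Lemma convolution_tail_le (R : realType) (G : probability (measurableTypeR R) R)
    (A x : R) :
  (convolution G G `]x, +oo[%classic <=
   (2 * tail G (x - A) + 2 * tail G A * tail G (x / 2))%:E)%E.
Proof.
rewrite /convolution /pushforward.
pose T a b : set (measurableTypeR R * measurableTypeR R) :=
  `]a, +oo[ `*` `]b, +oo[.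
pose L : set (measurableTypeR R * measurableTypeR R) := `]x - A, +oo[ `*` setT.
pose M : set (measurableTypeR R * measurableTypeR R) := setT `*` `]x - A, +oo[.
have mL : measurable L by exact: measurableX.
have mM : measurable M by exact: measurableX.
have mT a b : measurable (T a b) by exact: measurableX.
apply: (@le_trans _ _ ((G \x G)%E ((L `|` M) `|` (T A (x / 2) `|` T (x / 2) A)))).
  rewrite le_measure ?inE//; try exact: measurable_sum_gt.
    by apply: measurableU; exact: measurableU.
  move=> [u v] /=; rewrite /L /M /T /= !in_itv/= !andbT => uv.
  have [vA|vA] := leP v A; first by left; left; split => //; lra.
  have [uA|uA] := leP u A; first by left; right; split => //; lra.
  right; have [ux|ux] := ltP (x / 2) u; first by right.
  by left; split => //; lra.
apply: (le_trans (measureU2 _ _ _)); [exact: measurableU|exact: measurableU|].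
have := measureU2 (G \x G)%E mL mM.
have := measureU2 (G \x G)%E (mT A (x / 2)) (mT (x / 2) A).
rewrite /L /M /T /= !product_probabilityE// probability_setT !tail_measure mule1 mul1e.
move=> h1 h2; apply: (le_trans (leeD h2 h1)).
by rewrite -!EFinM -!EFinD lee_fin; lra.
Qed.

Lemma subexponential_of_dominated_long_tailed (R : realType)
    (G : probability (measurableTypeR R) R) :
  dominated_varying G -> long_tailed G -> subexponential G.
Proof.
move=> [Gp [c c0 Gc]] [G0 Glt]; split=> //.
apply/cvgrPdist_le => e e0.
(* By dominated variation, tail G (x / 2) <= tail G x / c, so this A makes the
   contribution of two jumps beyond A at most e * tail G x. *)
have [A GA] : exists A, tail G A <= c * (e / 2).
  have h : 0 < c * (e / 2) by rewrite mulr_gt0//; lra.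
  have := cvg_tail_y _ G => /cvgr_le/(_ _ h).
  by move=> [M [_ MG]]; exists (M + 1); apply: MG; rewrite ltrDl.
have e1 : (1 : R) < 1 + e / 2 by lra.
have e2 : 0 < 2 * e by lra.
near=> x.
have x0 : 0 <= x by near: x; apply: nbhs_pinfty_ge; exact: num_real.
have xA : tail G (x - A) <= (1 + e / 2) * tail G x.
  rewrite -ler_pdivrMr//; near: x.
  by have /cvgr_le/(_ _ e1) := Glt (- A).
have xe : tail G x <= 2 * e by near: x; by have /cvgr_le/(_ _ e2) := cvg_tail_y _ G.
have x2 : c * tail G (x / 2) <= tail G x.
  by have := Gc (x / 2); rewrite mulrCA divff// mulr1; apply; rewrite divr_ge0.
have AG : tail G A * tail G (x / 2) <= e / 2 * tail G x.
  apply: (le_trans (ler_wpM2r (tail_ge0 _ _ _) GA)).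
  by rewrite mulrAC mulrC ler_wpM2l//; lra.
have lo := convolution_tail_ge _ _ _ Gp x0.
have hi := convolution_tail_le _ G A x.
have : convolution G G `]x, +oo[%classic \is a fin_num.
  by rewrite fin_numElt (lt_le_trans _ lo) ?ltNyr// (le_lt_trans hi) ?ltry.
move=> /fineK cE; move: lo hi; rewrite -cE !lee_fin -/(tail (convolution G G) x).
move=> lo hi; have Gx := G0 x; have Gx2 : 0 < 2 * tail G x by lra.
have xx : tail G x ^+ 2 <= 2 * e * tail G x by rewrite expr2 ler_wpM2r// ltW.
rewrite distrC ler_norml lerBrDr lerBlDr ler_pdivlMr// ler_pdivrMr//.
by apply/andP; split; lra.
Unshelve. all: by end_near. Qed.

(** * Existence of the mixture *)

(** Dominated convergence; the restriction to nonnegative points makes the tail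
    of F itself a dominating function. *)
Lemma cvg_mixed_tail (R : realType) (F : probability (measurableTypeR R) R)
    (H : {measure set (measurableTypeR R) -> \bar R}) (u : nat -> R) (g : R -> R) :
  (mixed_tail F H 0 < +oo)%E ->
  measurable_fun setT (g : measurableTypeR R -> R) ->
  (forall n, 0 <= u n) ->
  (forall t, tail F (u n + t) @[n --> \oo] --> g t) ->
  mixed_tail F H (u n) @[n --> \oo] --> (\int[H]_(t in `[0%R, +oo[) (g t)%:E)%E.
Proof.
move=> m0 mg u0 ug.
have [] // := @dominated_convergence _ _ _ H `[0, +oo[%classic _
  (fun n t => (tail F (u n + t))%:E) (fun t => (g t)%:E)
  (fun t => (tail F (0 + t))%:E).
- by move=> n; exact: measurable_tail_shift.
- by apply/measurable_EFinP; exact: measurable_funTS.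
- by apply: aeW => t _; apply/cvg_EFin; [exact: nearW|exact: ug].
- apply/integrableP; split; first exact: measurable_tail_shift.
  apply: le_lt_trans m0; rewrite le_eqVlt; apply/orP; left; apply/eqP.
  by apply: eq_integral => t _; rewrite gee0_abs// lee_fin tail_ge0.
- apply: aeW => t n _; rewrite gee0_abs ?lee_fin ?tail_ge0//.
  by apply: tail_nonincreasing; rewrite lerD2r.
Qed.

Lemma mixed_tail_fin_num (R : realType) (F : probability (measurableTypeR R) R)
    (H : {measure set (measurableTypeR R) -> \bar R}) (x : R) :
  (mixed_tail F H 0 < +oo)%E -> 0 <= x -> mixed_tail F H x \is a fin_num.
Proof.
move=> m0 x0; rewrite ge0_fin_numE ?mixed_tail_ge0//.
exact: le_lt_trans (mixed_tail_nonincreasing _ _ _ _ _ x0) m0.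
Qed.

Lemma mixed_tail_right_continuous (R : realType) (F : probability (measurableTypeR R) R)
    (H : {measure set (measurableTypeR R) -> \bar R}) (p : R) :
  (mixed_tail F H 0 < +oo)%E -> 0 <= p ->
  fine (mixed_tail F H x) @[x --> p^'+] --> fine (mixed_tail F H p).
Proof.
move=> m0 p0; apply/cvg_at_rightP => u [pu up].
apply/fine_cvg; rewrite fineK ?mixed_tail_fin_num//.
apply: cvg_mixed_tail => //.
- by apply/measurable_EFinP; exact: measurable_tail_shift.
- by move=> n; rewrite (le_trans p0)// ltW.
move=> t; have /cvg_at_rightP := @tail_right_continuous _ F (p + t); apply; split.
  by move=> n; rewrite ltrD2r.
by apply: cvgD => //; exact: cvg_cst.
Qed.

Lemma cvg_mixed_tail_y (R : realType) (F : probability (measurableTypeR R) R)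
    (H : {measure set (measurableTypeR R) -> \bar R}) :
  (mixed_tail F H 0 < +oo)%E ->
  fine (mixed_tail F H x) @[x --> +oo] --> (0 : R).
Proof.
move=> m0; apply/cvg_pinftyP => u uy.
(* The first terms of u may be negative, where the domination fails. *)
have uP : \forall n \near \oo, Num.max 0 (u n) = u n.
  have : \forall n \near \oo, 0 <= u n by move/cvgryPge : uy; exact.
  by apply: filterS => n; exact: max_idPr.
have vy : Num.max 0 (u n) @[n --> \oo] --> +oo.
  by apply: cvg_trans uy; apply: near_eq_cvg; apply: filterS uP.
have : fine (mixed_tail F H (Num.max 0 (u n))) @[n --> \oo] --> (0 : R).
  apply/fine_cvg; rewrite -[X in _ --> X](@integral0 _ _ _ H `[0%R, +oo[%classic).
  apply: (@cvg_mixed_tail _ F H _ (cst 0)) => //.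
    by move=> n; rewrite le_max lexx.
  move=> t; have /cvg_pinftyP := cvg_tail_y _ F; apply.
  apply/cvgryPge => A; move/cvgryPge : vy => /(_ (A - t)).
  by apply: filterS => n; rewrite lerBlDr.
apply: cvg_trans; apply: near_eq_cvg; apply: filterS uP => n -> //.
Qed.

Definition mixture_cdf {R : realType} (F : probability (measurableTypeR R) R)
    (H : {measure set (measurableTypeR R) -> \bar R}) (x : R) : R :=
  if x < 0 then 0 else 1 - Num.min 1 (fine (mixed_tail F H x)).

Lemma mixture_cdf_nondecreasing (R : realType) (F : probability (measurableTypeR R) R)
    (H : {measure set (measurableTypeR R) -> \bar R}) :
  (mixed_tail F H 0 < +oo)%E -> nondecreasing (mixture_cdf F H).
Proof.
move=> m0 x y xy; rewrite /mixture_cdf.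
have [y0|y0] := ltP y 0; first by rewrite (le_lt_trans xy y0).
have [x0|x0] := ltP x 0; first by rewrite subr_ge0 ge_min lexx.
rewrite lerD2l lerN2 le_min ge_min lexx/= ge_min.
by rewrite fine_le ?mixed_tail_fin_num ?mixed_tail_nonincreasing ?orbT.
Qed.

Lemma mixture_cdf_right_continuous (R : realType) (F : probability (measurableTypeR R) R)
    (H : {measure set (measurableTypeR R) -> \bar R}) :
  (mixed_tail F H 0 < +oo)%E -> right_continuous (mixture_cdf F H).
Proof.
move=> m0 p; rewrite /mixture_cdf; have [p0|p0] := ltP p 0.
  apply: (@cvg_trans _ (cst (0 : R) @ p^'+)); last exact: cvg_cst.
  apply: near_eq_cvg; near=> x; suff -> : x < 0 by [].
  by near: x; exact: nbhs_right_lt.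
have : 1 - Num.min 1 (fine (mixed_tail F H x)) @[x --> p^'+] -->
    1 - Num.min 1 (fine (mixed_tail F H p)).
  apply: cvgB; first exact: cvg_cst.
  under eq_cvg do rewrite minr_absE.
  rewrite minr_absE; apply: cvgM; last exact: cvg_cst.
  have mp := mixed_tail_right_continuous _ _ _ _ m0 p0.
  apply: cvgB; first by apply: cvgD => //; exact: cvg_cst.
  by apply: cvg_norm; apply: cvgB => //; exact: cvg_cst.
apply: cvg_trans; apply: near_eq_cvg; near=> x.
have px : p < x by near: x; exact: nbhs_right_gt.
by rewrite ltNge (le_trans p0 (ltW px)).
Unshelve. all: by end_near. Qed.

Lemma cvg_mixture_cdf_Ny (R : realType) (F : probability (measurableTypeR R) R)
    (H : {measure set (measurableTypeR R) -> \bar R}) :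
  mixture_cdf F H x @[x --> -oo] --> (0 : R).
Proof.
apply: (@cvg_trans _ (cst (0 : R) @ -oo)); last exact: cvg_cst.
apply: near_eq_cvg; near=> x; rewrite /mixture_cdf; suff -> : x < 0 by [].
by near: x; apply: nbhs_ninfty_lt; exact: num_real.
Unshelve. all: by end_near. Qed.

Lemma cvg_mixture_cdf_y (R : realType) (F : probability (measurableTypeR R) R)
    (H : {measure set (measurableTypeR R) -> \bar R}) :
  (mixed_tail F H 0 < +oo)%E -> mixture_cdf F H x @[x --> +oo] --> (1 : R).
Proof.
move=> m0.
have : 1 - fine (mixed_tail F H x) @[x --> +oo] --> (1 - 0 : R).
  by apply: cvgB; [exact: cvg_cst|exact: cvg_mixed_tail_y].
rewrite subr0; apply: cvg_trans; apply: near_eq_cvg; near=> x.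
rewrite /mixture_cdf ltNge (_ : 0 <= x)/=; last first.
  by near: x; apply: nbhs_pinfty_ge; exact: num_real.
congr (1 - _); apply/esym/min_idPr; near: x.
by have /cvgr_le/(_ _ ltr01) := cvg_mixed_tail_y _ _ _ m0.
Unshelve. all: by end_near. Qed.

Lemma exists_probability_cdf (R : realType) (f : R -> R) :
  nondecreasing f -> right_continuous f ->
  f x @[x --> -oo] --> (0 : R) -> f x @[x --> +oo] --> (1 : R) ->
  exists G : probability (measurableTypeR R) R,
    forall x, G `]-oo, x]%classic = (f x)%:E.
Proof.
move=> f_nd f_rc f_Ny f_y.
pose C := isCumulative.Build R _ R f f_nd f_rc.
pose B := isCumulativeBounded.Build R 0 1 f f_Ny f_y.
pose f' : cumulativeBounded 0 1 := HB.pack f C B.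
exists (lebesgue_stieltjes_measure f') => x.
exact: (cdf_lebesgue_stieltjes_id f' x).
Qed.

(** The distribution function is 0 at every negative point, so the open negative
    half-line is a countable union of null sets. *)
Lemma exists_tail_mixture (R : realType) (F : probability (measurableTypeR R) R)
    (H : {measure set (measurableTypeR R) -> \bar R}) :
  (mixed_tail F H 0 < +oo)%E ->
  exists G : probability (measurableTypeR R) R, is_tail_mixture F H G.
Proof.
move=> m0.
have [G GE] := exists_probability_cdf _ _ (mixture_cdf_nondecreasing _ _ _ m0)
  (mixture_cdf_right_continuous _ _ _ m0) (cvg_mixture_cdf_Ny _ F H)
  (cvg_mixture_cdf_y _ _ _ m0).
exists G; split.
  apply: (@subset_measure0 _ _ _ G _ (\bigcup_n `]-oo, - n.+1%:R^-1 : R]%classic)) => //.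
  - exact: bigcup_measurable.
  - move=> y /=; rewrite in_itv/= => y0.
    exists (Num.truncn (- y)^-1) => //=; rewrite in_itv/= lerNr.
    rewrite -[leRHS]invrK lef_pV2 ?posrE ?invr_gt0 ?oppr_gt0//.
    exact/ltW/truncnS_gt.
  - apply/negligibleP; first exact: bigcup_measurable.
    apply: negligible_bigcup => n; apply/negligibleP => //.
    by apply: (etrans (GE _)); rewrite /mixture_cdf oppr_lt0 invr_gt0 ltr0Sn.
move=> x x0; rewrite tailE ccdf_1_cdf /cdf /distribution /pushforward preimage_id.
rewrite GE /mixture_cdf ltNge x0/= -EFinB opprB addrC subrK.
by rewrite -/(mixed_tail F H x) EFin_min fineK ?mixed_tail_fin_num.
Qed.

Theorem lemma8 (R : realType) (F : probability (measurableTypeR R) R)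
    (H : {measure set (measurableTypeR R) -> \bar R})
    (F_Rplus : on_Rplus F)
    (H_Rplus : on_Rplus H)
    (H_neq0 : H [set: measurableTypeR R] <> 0%E)
    (FH_fin : (\int[H]_(t in `[0%R, +oo[) (tail F t)%:E < +oo)%E)
    (F_dv : dominated_varying F)
    (F_lt : long_tailed F) :
  (exists G : probability (measurableTypeR R) R, is_tail_mixture F H G) /\
  (forall G : probability (measurableTypeR R) R, is_tail_mixture F H G ->
    [/\ dominated_varying G, long_tailed G & subexponential G]).
Proof.
split=> [|G FHG].
  apply: exists_tail_mixture; rewrite /mixed_tail.
  by under eq_integral do rewrite add0r.
have G_dv := mixture_dominated_varying _ _ _ _ FHG (F_lt.1 0) F_dv.
have G_lt := mixture_long_tailed _ _ _ _ FHG H_Rplus H_neq0 F_lt.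
by split=> //; exact: subexponential_of_dominated_long_tailed.
Qed.
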